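(* Let $X$ be an infinite set. Then the symmetric inverse monoid $\mathcal{I}_X$ is f-noetherian.
   Context: A right congruence on a semigroup $S$ is an equivalence relation $\rho$ on $S$ such that $(a,b)\in\rho$ implies $(as,bs)\in\rho$ for all $s\in S$. The right congruence generated by a set $Z\subseteq S\times S$ is the smallest right congruence on $S$ containing $Z$; a right congruence is finitely generated if it is generated by some finite set $Z$. The index of an equivalence relation is the cardinality of its set of equivalence classes. A semigroup $S$ is f-noetherian if every right congruence of finite index on $S$ is finitely generated. $\mathcal{I}_X$ is the monoid of all partial injective maps on $X$ (bijections between subsets of $X$) under composition of partial maps, with maps written on the right and composed from left to right. *)

(* Defs.v *)
From HB Require Import structures.
From mathcomp Require Import all_boot.
From mathcomp Require Import boolp classical_sets functions cardinality.

Set Implicit Arguments.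
Unset Strict Implicit.
Unset Printing Implicit Defensive.

Local Open Scope classical_set_scope.
Local Open Scope group_scope.

Section RightCongruences.
Variable S : semigroupType.
Implicit Types rho Z : set (S * S)%type.

Record right_congruence rho : Prop := RightCongruence {
  right_congruence_refl : forall a, rho (a, a);
  right_congruence_sym : forall a b, rho (a, b) -> rho (b, a);
  right_congruence_trans :
    forall a b c, rho (a, b) -> rho (b, c) -> rho (a, c);
  right_congruence_mul : forall a b s, rho (a, b) -> rho (a * s, b * s)
}.

(* [smallest C Z] is the intersection of the sets satisfying [C] that
   contain [Z]; right congruences are closed under intersection. *)
Definition generated_right_congruence Z : set (S * S)%type :=
  smallest right_congruence Z.

Definition finitely_generated rho : Prop :=
  exists2 Z, finite_set Z & rho = generated_right_congruence Z.

Definition eqclass rho (a : S) : set S := [set b | rho (a, b)].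

Definition finite_index rho : Prop := finite_set (range (eqclass rho)).

Definition f_noetherian : Prop :=
  forall rho, right_congruence rho -> finite_index rho ->
    finitely_generated rho.

Lemma generated_right_congruenceP Z :
  right_congruence (generated_right_congruence Z).
Proof.
split=> [a|a b ab|a b c ab bc|a b s ab] rho [rhoC Zrho].
- exact: right_congruence_refl.
- exact: right_congruence_sym (ab _ _).
- exact: right_congruence_trans (ab _ _) (bc _ _).
- exact: right_congruence_mul (ab _ _).
Qed.

End RightCongruences.

(* A partial injective map is encoded as a total function to [option X]:
   [f x = None] means that [x] is outside the domain of [f]. *)
Record pinj (X : Type) := PInj {
  pinj_fun :> X -> option X;
  pinj_inj : forall x y z, pinj_fun x = Some z -> pinj_fun y = Some z -> x = y
}.

Section SymmetricInverseMonoid.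
Variable X : Type.
Implicit Types f g h : pinj X.

Lemma pinj_ext f g : f =1 g -> f = g.
Proof.
case: f g => [f f_inj] [g g_inj] /= /funext fg.
by case: g / fg g_inj => g_inj; congr PInj; apply: Prop_irrelevance.
Qed.

Fact pinj_one_subproof (x y z : X) : Some x = Some z -> Some y = Some z -> x = y.
Proof. by move=> [->] [->]. Qed.

Definition pinj_one : pinj X := PInj pinj_one_subproof.

Fact pinj_mul_subproof f g x y z :
  obind g (f x) = Some z -> obind g (f y) = Some z -> x = y.
Proof.
case fx: (f x) => [u|] //=; case fy: (f y) => [v|] //= gu gv.
by apply: (pinj_inj fx); rewrite (pinj_inj gu gv).
Qed.

(* Maps act on the right: [f * g] is [f] followed by [g]. *)
Definition pinj_mul f g : pinj X := PInj (@pinj_mul_subproof f g).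

Fact pinj_mulA : associative pinj_mul.
Proof. by move=> f g h; apply: pinj_ext => x /=; case: (f x). Qed.

Fact pinj_mul1g : left_id pinj_one pinj_mul.
Proof. by move=> f; apply: pinj_ext. Qed.

Fact pinj_mulg1 : right_id pinj_one pinj_mul.
Proof. by move=> f; apply: pinj_ext => x /=; case: (f x). Qed.

HB.instance Definition _ := gen_eqMixin (pinj X).
HB.instance Definition _ := gen_choiceMixin (pinj X).
HB.instance Definition _ :=
  isMonoid.Build (pinj X) pinj_mulA pinj_mul1g pinj_mulg1.

End SymmetricInverseMonoid.

(* Main.v *)
Require Import Defs.
From mathcomp Require Import all_boot.
From mathcomp Require Import boolp classical_sets functions cardinality.

(** Every right congruence of finite index on the symmetric inverse monoid is
    universal, and the universal one is generated by the single pair (1, 0),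
    where 0 is the empty map: from (1, 0) one gets (s, 0) by multiplying by
    any s, hence all pairs.

    A right congruence of finite index amounts to a right action of the monoid
    on a finite set, the set of its classes. If s * t = 1, then s acts
    injectively, hence bijectively, with inverse t, so the idempotent t * s
    acts trivially although it may differ from 1
    ([finite_index_mul_retraction]). Take for s a total injection f of X: the
    idempotent t * s is then the restriction of the identity to the range of f.
    An infinite X has two self-injections with disjoint ranges
    ([ex_disjoint_injections]); the two idempotents act trivially and their
    product is 0, so 0 acts trivially too and 1 is related to 0
    ([finite_index_one_zero]).

    The two injections come from a partition of X into infinite sequences,
    obtained with Zorn's lemma: f and g send the term of index n of a sequence
    to the terms of index 2n and 2n + 1 of the same sequence. *)

Set Implicit Arguments.
Unset Strict Implicit.
Unset Printing Implicit Defensive.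

Local Open Scope classical_set_scope.

Lemma infinite_set_seq (X : Type) (A : set X) : infinite_set A ->
  exists2 v : nat -> X, injective v & range v `<=` A.
Proof.
elim/Ppointed: X A => X A Ainf.
  by case: Ainf; rewrite (_ : A = set0) ?emptyE//; exact: finite_set0.
have /infiniteP/pcard_leP[f] := Ainf.
exists f; first by move=> i j /inj; apply; rewrite inE.
by move=> _ [i _ <-]; exact: funS.
Qed.

Lemma countable_infinite_set_enum (X : Type) (A : set X) :
  countable A -> infinite_set A ->
  exists2 v : nat -> X, injective v & range v = A.
Proof.
elim/Ppointed: X A => X A Acnt Ainf.
  by case: Ainf; rewrite (_ : A = set0) ?emptyE//; exact: finite_set0.
have := eq_card_nat Acnt Ainf; rewrite card_eq_sym => /card_set_bijP[f].
move=> [fA f_inj f_surj]; exists f.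
  by move=> i j /f_inj; apply; rewrite inE.
by apply/seteqP; split=> [_ [i _ <-]|x Ax]; [exact: fA|exact: f_surj].
Qed.

Section SequencePartition.
Variable X : Type.
Implicit Types (P : set (nat -> X)) (u v : nat -> X).

(** Taking [u = v] shows that each member of [P] is injective: a single
    condition expresses that the members enumerate, without repetition,
    pairwise disjoint subsets of [X]. *)
Definition disjoint_sequences P :=
  forall u v i j, P u -> P v -> u i = v j -> u = v /\ i = j.

Lemma ex_maximal_disjoint_sequences :
  exists P, disjoint_sequences P /\
    forall Q, P `<` Q -> ~ disjoint_sequences Q.
Proof.
apply: Zorn_bigcup => F Fdisj Ftot u v i j [P FP Pu] [Q FQ Qv].
have [PQ|QP] := Ftot _ _ FP FQ.
- exact: Fdisj FQ _ _ _ _ (PQ _ Pu) Qv.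
- exact: Fdisj FP _ _ _ _ Pu (QP _ Qv).
Qed.

Lemma disjoint_sequencesU1 P v :
  disjoint_sequences P -> injective v ->
  (forall u i j, P u -> u i <> v j) ->
  disjoint_sequences (v |` P).
Proof.
move=> Pdisj v_inj Pv u w i j [->|Pu] [->|Pw].
- by move=> /v_inj.
- by move=> /esym/(Pv _ _ _ Pw).
- by move=> /(Pv _ _ _ Pu).
- exact: Pdisj.
Qed.

(** A maximal family of disjoint sequences misses only finitely many points,
    since an infinite remainder would contain one more sequence. These points
    are absorbed into one member [u0] of the family: adding them to its range
    leaves a countably infinite set, which a single sequence [v] enumerates. *)
Lemma ex_sequence_partition : infinite_set [set: X] ->
  exists2 P, disjoint_sequences P & forall x, exists2 u, P u & range u x.
Proof.
move=> Xinf; have [P [Pdisj Pmax]] := ex_maximal_disjoint_sequences.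
pose R := [set x | forall u, P u -> ~ range u x].
have Rfin : finite_set R.
  apply: contrapT => /infinite_set_seq[v v_inj vR].
  apply: (Pmax (v |` P)).
    split=> [u Pu|Psub]; first by right.
    have Pv : P v by apply: Psub; left.
    by apply: (vR (v 0) _ v Pv); exists 0.
  apply: disjoint_sequencesU1 => // u i j Pu uv.
  by apply: (vR (v j) _ u Pu); [exists j|exists i].
have [u0 Pu0] : exists u, P u.
  apply: contrapT => Pempty; apply: Xinf.
  by apply: sub_finite_set Rfin => x _ u Pu; case: Pempty; exists u.
have u0_inj : injective u0 by move=> i j /(Pdisj _ _ _ _ Pu0 Pu0)[].
have [v v_inj v_range] : exists2 v : nat -> X, injective v & range v = R `|` range u0.
  apply: countable_infinite_set_enum.
    rewrite -bigcup2E; apply: bigcup_countable => // -[|[|i]] _ //=.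
      exact: finite_set_countable.
    exact: card_image_le.
  apply: sub_infinite_set (@subsetUr _ _ _) _ => u0fin.
  apply: infinite_nat; rewrite -(preimage_range u0).
  by apply: finite_preimage u0fin => i j _ _; exact: u0_inj.
exists (v |` (P `\ u0)).
  apply: disjoint_sequencesU1 => // [u w i j [Pu _] [Pw _]|u i j [Pu uN]].
    exact: Pdisj.
  move=> uv; have [] : (R `|` range u0) (u i) by rewrite -v_range uv; exists j.
    by move=> /(_ u Pu); apply; exists i.
  by move=> [k _] /(Pdisj _ _ _ _ Pu0 Pu)[/esym].
move=> x; have [[u [Pu ux]]|xN] := pselect (exists u, P u /\ range u x).
  have [uu0|uN] := pselect (u = u0); last by exists u => //; right.
  by exists v; [left|rewrite v_range -uu0; right].
exists v; [by left|rewrite v_range; left => u Pu ux].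
by apply: xN; exists u.
Qed.

(** With [X] partitioned into sequences, shifting the index [n] to [2n] or
    [2n + 1] inside each sequence splits [X] into two copies of itself. *)
Lemma ex_disjoint_injections : infinite_set [set: X] ->
  exists f g : X -> X,
    [/\ injective f, injective g & forall x y, f x <> g y].
Proof.
move=> /ex_sequence_partition[P Pdisj Pcover].
have /choice[p pP] x : exists p : (nat -> X) * nat, P p.1 /\ p.1 p.2 = x.
  by have [u Pu [i _ ux]] := Pcover x; exists (u, i).
have spread_inj x y i j : (p x).1 i = (p y).1 j -> (p x).1 = (p y).1 /\ i = j.
  by have [[? _] [? _]] := (pP x, pP y); exact: Pdisj.
exists (fun x => (p x).1 (p x).2.*2), (fun x => (p x).1 (p x).2.*2.+1); split.
- move=> x y /spread_inj[xy /double_inj xy2].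
  by have [_ <-] := pP x; rewrite xy xy2; case: (pP y).
- move=> x y /spread_inj[xy [/double_inj xy2]].
  by have [_ <-] := pP x; rewrite xy xy2; case: (pP y).
- by move=> x y /spread_inj[_] /(congr1 odd); rewrite oddS !odd_double.
Qed.

End SequencePartition.

Local Open Scope group_scope.

Section RightCongruence.
Variables (M : monoidType) (rho : set (M * M)).
Hypotheses (rhoC : right_congruence rho) (rho_fin : finite_index rho).

Lemma finite_index_pigeonhole (u : nat -> M) :
  exists m k, rho (u m, u (m + k.+1)%N).
Proof.
apply: contrapT => uN; apply: infinite_nat.
have classI m n : eqclass rho (u m) = eqclass rho (u n) -> rho (u m, u n).
  move=> mn; have : eqclass rho (u n) (u n) by exact: right_congruence_refl.
  by rewrite -mn.
have := @finite_preimage _ _ _ (eqclass rho \o u) _ rho_fin.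
have -> : (eqclass rho \o u) @^-1` range (eqclass rho) = setT.
  by apply/seteqP; split=> // n _; exists (u n).
apply=> m n _ _ /= mn; apply: contrapT => /eqP; rewrite neq_ltn.
case/orP=> [lt_mn|lt_nm]; apply: uN.
- by exists m, (n - m.+1)%N; rewrite addnS -addSn subnKC//; exact: classI.
- by exists n, (m - n.+1)%N; rewrite addnS -addSn subnKC//; exact: classI.
Qed.

(** Right multiplication by [s] permutes the finitely many classes, since
    multiplication by [t] undoes it. The pigeonhole principle on the powers
    [a * s ^+ n] makes this effective: it gives [k] such that [a] is related
    to [a * s ^+ k * s], so that [a] is the image under [s] of the class of
    [a * s ^+ k], which must also be the class of [a * t]. *)
Lemma finite_index_mul_retraction (s t a : M) :
  s * t = 1 -> rho (a, a * t * s).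
Proof.
move=> st1.
have [m [k mk]] := finite_index_pigeonhole (fun n => a * s ^+ n).
have stX n : s ^+ n * t ^+ n = 1.
  elim: n => [|n IHn]; first by rewrite mulg1.
  by rewrite expgSr expgS mulgA -(mulgA _ s t) st1 mulg1.
have abs : rho (a, a * s ^+ k * s).
  have := right_congruence_mul rhoC (t ^+ m) mk.
  by rewrite addnC expgnDr !mulgA -!(mulgA _ (s ^+ m)) stX !mulg1 expgSr mulgA.
have atb : rho (a * t, a * s ^+ k).
  have := right_congruence_mul rhoC t abs.
  by rewrite -!(mulgA _ s t) st1 mulg1.
apply: right_congruence_trans abs _ => //.
exact/(right_congruence_sym rhoC)/(right_congruence_mul rhoC).
Qed.

End RightCongruence.

Section InjectionInverse.
Variables (X : Type) (f : X -> X).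
Hypothesis f_inj : injective f.

Definition pinj_of_injection : pinj X.
Proof.
by exists (Some \o f) => x y z /= [<-] [/f_inj].
Defined.

Definition preimage_option (y : X) : option X :=
  if pselect (exists x, f x = y) is left ex then Some (projT1 (cid ex))
  else None.

Lemma preimage_optionP x y : preimage_option y = Some x <-> f x = y.
Proof.
rewrite /preimage_option; case: pselect => [ex|nex]; last first.
  by split=> // fxy; case: nex; exists x.
case: cid => z /= fz; split=> [[<-//]|fx].
by congr Some; apply: f_inj; rewrite fz fx.
Qed.

Definition pinj_inverse : pinj X.
Proof.
by exists preimage_option => x y z /preimage_optionP<- /preimage_optionP.
Defined.

Lemma pinj_of_injectionV : pinj_of_injection * pinj_inverse = 1.
Proof. by apply: pinj_ext => x /=; apply/preimage_optionP. Qed.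

(** The product is an idempotent, the identity of the range of [f]. In this
    form, two such idempotents with disjoint ranges have an empty product. *)
Lemma pinj_inverse_mulE x y :
  (pinj_inverse * pinj_of_injection) x = Some y -> x = y /\ exists z, f z = x.
Proof.
rewrite /=; case vx: (preimage_option x) => [z|] //= [<-].
by move/preimage_optionP: vx => <-; split=> //; exists z.
Qed.

End InjectionInverse.

Definition pinj_zero (X : Type) : pinj X.
Proof. by exists (fun=> None). Defined.

Lemma pinj_mul0g (X : Type) (s : pinj X) : pinj_zero X * s = pinj_zero X.
Proof. exact: pinj_ext. Qed.

(** The idempotents [e] and [e'] fix disjoint subsets of [X] pointwise and
    both act trivially on the classes, so 1, [e] and [e * e' = 0] are all
    related. *)
Lemma finite_index_one_zero (X : Type) (rho : set (pinj X * pinj X)) :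
  infinite_set [set: X] -> right_congruence rho -> finite_index rho ->
  rho (1, pinj_zero X).
Proof.
move=> /ex_disjoint_injections[f [g [f_inj g_inj fg]]] rhoC rho_fin.
pose e := pinj_inverse f_inj * pinj_of_injection f_inj.
pose e' := pinj_inverse g_inj * pinj_of_injection g_inj.
have e1 : rho (1, e).
  have := finite_index_mul_retraction rhoC rho_fin 1 (pinj_of_injectionV f_inj).
  by rewrite mul1g.
have ee' : rho (e, e * e').
  have := finite_index_mul_retraction rhoC rho_fin e (pinj_of_injectionV g_inj).
  by rewrite -mulgA.
suff <- : e * e' = pinj_zero X by exact: (right_congruence_trans rhoC) e1 ee'.
apply: pinj_ext => x.
(* Applying the product only one step keeps [e] and [e'] folded. *)
change (obind e' (e x) = None).
case ex: (e x) => [y|] //=; case e'y: (e' y) => [z|] //.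
have [xy [a fa]] := pinj_inverse_mulE ex.
have [_ [b gb]] := pinj_inverse_mulE e'y.
by case: (fg a b); rewrite fa gb.
Qed.

Theorem proposition3p4 (X : Type) (hX : infinite_set [set: X]) :
  f_noetherian (pinj X).
Proof.
move=> rho rhoC rho_fin.
have rho10 := finite_index_one_zero hX rhoC rho_fin.
exists [set (1, pinj_zero X)]; first exact: finite_set1.
apply/seteqP; split=> [[a b] _|z]; last first.
  by apply: smallest_sub => // _ ->.
have genC := generated_right_congruenceP [set (1 : pinj X, pinj_zero X)].
have gen0 s : generated_right_congruence [set (1, pinj_zero X)] (s, pinj_zero X).
  have := right_congruence_mul genC s (sub_gen_smallest (erefl _)).
  by rewrite mul1g pinj_mul0g.
exact: (right_congruence_trans genC) (gen0 a) (right_congruence_sym genC (gen0 b)).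
Qed.
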